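(* Let $d\geq 2$ and let $X$ be a free basis of the free group $F_d$ of rank $d$. Then there exists a chain $(\Gamma_n)_{n\ge0}$ in $F_d$ with $\bigcap_n\Gamma_n=1$, whose boundary representation on $\partial T$, where $T=T(F_d,(\Gamma_n))$, is not essentially free, such that: (1) for all $x$ in a comeager subset of $\partial T$, the Schreier graph with respect to $X$ of the orbit of $x$ is a $2d$-regular tree; (2) for $\mu$-almost every $x\in\partial T$, the Schreier graph with respect to $X$ of the orbit of $x$ is not a tree, and some finite ball in it cannot be embedded into the $2d$-regular tree. In particular, the action of $F_d$ on $T$ is spherically transitive, and the Schreier graphs of orbits on the boundary of points typical in the sense of Baire category are not locally isomorphic to the Schreier graphs of orbits of points typical in the sense of measure.
   Context: A chain in a group $\Gamma$ is a sequence $\Gamma=\Gamma_0\geq\Gamma_1\geq\Gamma_2\geq\cdots$ of subgroups of finite index in $\Gamma$ (not necessarily normal). The coset tree $T=T(\Gamma,(\Gamma_n))$ has as vertices the right cosets $\Gamma_n g$ ($n\ge 0$, $g\in\Gamma$), where the cosets of $\Gamma_n$ form level $n$; there is an edge between $\Gamma_n g$ and $\Gamma_{n+1}h$ exactly when $\Gamma_n g\supseteq\Gamma_{n+1}h$. It is a tree rooted at the vertex $\Gamma=\Gamma_0$, and $\Gamma$ acts on it by automorphisms via right multiplication on cosets. The action on $T$ is spherically transitive if it is transitive on each level. The boundary $\partial T$ is the set of infinite rays starting from the root. For a vertex $t=\Gamma_n g$ its shadow is $\mathrm{Sh}(t)=\{x\in\partial T\mid t\in x\}$. The shadows form a base of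 the topology on $\partial T$, and $\mu$ is the Borel probability measure on $\partial T$ with $\mu(\mathrm{Sh}(\Gamma_n g))=1/|\Gamma:\Gamma_n|$. The induced action of $\Gamma$ on $\partial T$ by measure-preserving homeomorphisms is called the boundary representation of $\Gamma$ with respect to $(\Gamma_n)$. It is essentially free if $\mu$-almost every $x\in\partial T$ has trivial stabilizer in $\Gamma$. The Schreier graph, with respect to $X$, of the orbit of $x\in\partial T$ is the undirected multigraph (loops and multiple edges allowed) whose vertex set is the orbit $x\Gamma$ and which has, for each vertex $y$ and each $s\in X$, one edge joining $y$ and $ys$. A graph with a loop or a multiple edge is not a tree. A property holds for points typical in the sense of Baire category if it holds on a comeager subset (the complement of a countable union of nowhere dense closed sets) of $\partial T$, and for points typical in the sense of measure if it holds $\mu$-almost everywhere. Two graphs are locally isomorphic if the isomorphism classes of finite balls coincide for the two graphs. *)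

(* Defs.v *)
From HB Require Import structures.
From mathcomp Require Import all_boot all_order all_algebra.
From mathcomp Require Import finmap zify.
From mathcomp Require Import all_classical all_reals all_analysis.

Set Implicit Arguments.
Unset Strict Implicit.
Unset Printing Implicit Defensive.

Local Open Scope classical_set_scope.
Local Open Scope group_scope.

(* The universal property. A group [F] with a free basis indexed by ['I_d] is
   a free group of rank [d]. *)
Definition free_basis (d : nat) (F : groupType) (X : 'I_d -> F) : Prop :=
  forall (G : groupType) (h : 'I_d -> G),
    exists! f : F -> G,
      {morph f : x y / x * y >-> x * y} /\ forall i, f (X i) = h i.

Section Cosets.
Variable F : groupType.
Implicit Types (H C : set F) (g : F).

Definition is_subgroup H : Prop :=
  [/\ H 1, forall x y, H x -> H y -> H (x * y) & forall x, H x -> H x^-1].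

Definition translate C g : set F := [set x * g | x in C].

Definition right_cosets H : set (set F) := range (translate H).

(* Meaningful when [right_cosets H] is finite ([fset_set] of an infinite set
   is empty). *)
Definition subgroup_index H : nat := #|` fset_set (right_cosets H)|%fset.

Lemma translateM C g h : translate (translate C g) h = translate C (g * h).
Proof.
rewrite /translate; apply/seteqP; split => [_ [_ [x Cx <-] <-]|_ [x Cx <-]].
  by exists x; rewrite ?mulgA.
by exists (x * g); [exists x | rewrite mulgA].
Qed.

Lemma translate1 C : translate C 1 = C.
Proof.
rewrite /translate; apply/seteqP; split => [_ [x Cx <-]|x Cx].
  by rewrite mulg1.
by exists x; rewrite ?mulg1.
Qed.

Lemma translate_sub C C' g : C `<=` C' -> translate C g `<=` translate C' g.
Proof. by move=> CC' _ [x Cx <-]; exists x => //; apply: CC'. Qed.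

Lemma right_cosets_translate H C g :
  right_cosets H C -> right_cosets H (translate C g).
Proof. by case=> h _ <-; exists (h * g) => //; rewrite translateM. Qed.

Lemma right_coset_eq H C g :
  is_subgroup H -> right_cosets H C -> C g -> C = translate H g.
Proof.
move=> [H1 HM HV] [h _ <-] [k Hk <-]; rewrite /translate.
apply/seteqP; split => [_ [x Hx <-]|_ [x Hx <-]].
  exists (x * k^-1); [exact: HM (HV _ _)|by rewrite mulgA mulgVK].
by exists (x * k); [exact: HM|rewrite mulgA].
Qed.

End Cosets.

Record chain (F : groupType) := Chain {
  chain_set :> nat -> set F;
  chain_subgroup : forall n, is_subgroup (chain_set n);
  chain_finite_index : forall n, finite_set (right_cosets (chain_set n));
  chain_top : chain_set 0 = setT;
  chain_decr : forall n, chain_set n.+1 `<=` chain_set n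
}.

(* The level is part of a vertex: when Gamma_n = Gamma_(n+1), the same subset
   of F gives one vertex on each of the levels n and n + 1. *)
Record vertex (F : groupType) (Gam : chain F) := Vertex {
  level : nat;
  coset_of_vertex : set F;
  vertexP : right_cosets (Gam level) coset_of_vertex
}.

Section CosetTree.
Variables (F : groupType) (Gam : chain F).
Local Notation vertex := (vertex Gam).
Implicit Types (u v w : vertex) (g : F).

HB.instance Definition _ := gen_eqMixin vertex.
HB.instance Definition _ := gen_choiceMixin vertex.

Definition vertex_of (n : nat) (g : F) : vertex :=
  @Vertex F Gam n (translate (Gam n) g) (imageT (translate (Gam n)) g).

Definition tree_root : vertex := vertex_of 0 1.

HB.instance Definition _ := isPointed.Build vertex tree_root.

Definition child u v : Prop :=
  level v = (level u).+1 /\ coset_of_vertex v `<=` coset_of_vertex u.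

Definition adjacent u v : Prop := child u v \/ child v u.

Definition vact v g : vertex :=
  Vertex (right_cosets_translate g (vertexP v)).

Definition spherically_transitive : Prop :=
  forall n u v, level u = n -> level v = n -> exists g, vact u g = v.

Lemma vertex_eq u v :
  level u = level v -> coset_of_vertex u = coset_of_vertex v -> u = v.
Proof.
case: u v => [n C p] [m D q] /= nm CD; move: p q; rewrite nm CD => p q.
by rewrite (Prop_irrelevance p q).
Qed.

Lemma coset_inhabited v : exists g, coset_of_vertex v g.
Proof.
have [g _ <-] := vertexP v; exists g; exists 1; last by rewrite mul1g.
by case: (chain_subgroup Gam (level v)).
Qed.

Lemma parent_uniq u v w : child u w -> child v w -> u = v.
Proof.
move=> [lu su] [lv sv]; have [g wg] := coset_inhabited w.
have luv : level u = level v by apply: succn_inj; rewrite -lu -lv.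
apply: vertex_eq => //.
have sub n := chain_subgroup Gam n.
rewrite (right_coset_eq (sub _) (vertexP u) (su _ wg)).
by rewrite (right_coset_eq (sub _) (vertexP v) (sv _ wg)) luv.
Qed.

Lemma vactM v g h : vact (vact v g) h = vact v (g * h).
Proof. by apply: vertex_eq => //=; rewrite translateM. Qed.

Lemma vact1 v : vact v 1 = v.
Proof. by apply: vertex_eq => //=; rewrite translate1. Qed.

Lemma vact_inj g : injective (vact^~ g).
Proof.
by move=> u v /(congr1 (vact^~ g^-1)) /=; rewrite !vactM mulgV !vact1.
Qed.

Lemma vact_root g : vact tree_root g = tree_root.
Proof.
apply: vertex_eq => //=; rewrite chain_top translate1 /translate.
by apply/seteqP; split => // x _; exists (x * g^-1); rewrite ?mulgVK.
Qed.

Lemma vact_adjacent u v g : adjacent u v -> adjacent (vact u g) (vact v g).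
Proof.
by case=> -[l s]; [left|right]; split => //=; apply: translate_sub.
Qed.

End CosetTree.

Record boundary (F : groupType) (Gam : chain F) := Ray {
  ray :> nat -> vertex Gam;
  ray_root : ray 0 = tree_root Gam;
  ray_adjacent : forall n, adjacent (ray n) (ray n.+1);
  ray_inj : injective ray
}.

Section Boundary.
Variables (F : groupType) (Gam : chain F).
Local Notation vertex := (vertex Gam).
Local Notation boundary := (boundary Gam).
Implicit Types (v : vertex) (x y : boundary) (g : F).

Lemma ray_child x n : child (x n) (x n.+1).
Proof.
elim: n => [|n IH].
  by have [//|[]] := ray_adjacent x 0; rewrite ray_root.
have [//|c] := ray_adjacent x n.+1.
by have /ray_inj := parent_uniq IH c; lia.
Qed.

Lemma ray_level x n : level (x n) = n.
Proof.
elim: n => [|n IH]; first by rewrite ray_root.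
by case: (ray_child x n) => ->; rewrite IH.
Qed.

Lemma ray_eq x y : (forall n, x n = y n) -> x = y.
Proof.
case: x y => [f f0 fa fi] [h h0 ha hi] /= /funext fh.
move: f0 fa fi h0 ha hi; rewrite fh => f0 fa fi h0 ha hi.
by congr Ray; apply: Prop_irrelevance.
Qed.

HB.instance Definition _ := gen_eqMixin boundary.
HB.instance Definition _ := gen_choiceMixin boundary.

Lemma base_ray_root : vertex_of Gam 0 1 = tree_root Gam.
Proof. by []. Qed.

Lemma base_ray_adjacent n :
  adjacent (vertex_of Gam n 1) (vertex_of Gam n.+1 1).
Proof. by left; split => //=; apply: translate_sub; apply: chain_decr. Qed.

Lemma base_ray_inj : injective (fun n => vertex_of Gam n 1).
Proof. by move=> n m /(congr1 (@level _ _)). Qed.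

Definition base_ray : boundary :=
  Ray base_ray_root base_ray_adjacent base_ray_inj.

HB.instance Definition _ := isPointed.Build boundary base_ray.

Definition shadow v : set boundary := [set x | exists n, x n = v].

Lemma shadow_cover : \bigcup_(v in setT) shadow v = setT.
Proof. by apply/seteqP; split => // x _; exists (x 0) => //; exists 0. Qed.

Lemma shadow_sub x n m : n <= m -> shadow (x m) `<=` shadow (x n).
Proof.
move=> nm y [k yk]; exists n.
have km : k = m by rewrite -(ray_level y k) yk ray_level.
move: yk; rewrite {k}km -(subnK nm); elim: (m - n) => [//|k IH] e.
apply: IH; rewrite addSn in e; have := ray_child x (k + n).
by rewrite -e => c; apply: parent_uniq (ray_child y _) c.
Qed.

Lemma shadow_join u v x : setT u -> setT v -> shadow u x -> shadow v x ->
  exists w, [/\ setT w, shadow w x & shadow w `<=` shadow u `&` shadow v].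
Proof.
move=> _ _ [n <-] [m <-]; exists (x (maxn n m)); split => //.
  by exists (maxn n m).
by move=> y yw; split; apply: shadow_sub yw; rewrite ?leq_maxl ?leq_maxr.
Qed.

HB.instance Definition _ :=
  @isBaseTopological.Build boundary vertex setT shadow
    shadow_cover shadow_join.

Lemma bact_root x g : vact (x 0) g = tree_root Gam.
Proof. by rewrite ray_root vact_root. Qed.

Lemma bact_adjacent x g n : adjacent (vact (x n) g) (vact (x n.+1) g).
Proof. exact/vact_adjacent/ray_adjacent. Qed.

Lemma bact_inj x g : injective (fun n => vact (x n) g).
Proof. by move=> n m /vact_inj /ray_inj. Qed.

Definition bact x g : boundary :=
  Ray (bact_root x g) (bact_adjacent x g) (@bact_inj x g).

Definition stabilizer x : set F := [set g | bact x g = x].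

Definition borbit x : set boundary := range (bact x).

Lemma bactM x g h : bact (bact x g) h = bact x (g * h).
Proof. by apply: ray_eq => n /=; rewrite vactM. Qed.

Lemma orbit_bact x y g : borbit x y -> borbit x (bact y g).
Proof. by case=> h _ <-; exists (h * g) => //; rewrite bactM. Qed.

End Boundary.

(* The boundary with its Borel sigma-algebra. *)
Notation borel_boundary Gam :=
  (g_sigma_algebraType (@open (boundary Gam))).

Definition is_boundary_measure (R : realType) (F : groupType) (Gam : chain F)
    (mu : probability (borel_boundary Gam) R) : Prop :=
  forall v : vertex Gam,
    mu (shadow v) = (((subgroup_index (Gam (level v)))%:R^-1)%R : R)%:E.

Definition essentially_free (R : realType) (F : groupType) (Gam : chain F)
    (mu : probability (borel_boundary Gam) R) : Prop :=
  {ae mu, forall x : boundary Gam, stabilizer x = [set 1]}.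

Definition nowhere_dense (T : topologicalType) (A : set T) : Prop :=
  interior (closure A) = set0.

Definition comeager (T : topologicalType) (A : set T) : Prop :=
  exists C : nat -> set T,
    (forall n, closed (C n) /\ nowhere_dense (C n)) /\
    A = ~` \bigcup_n C n.

(* Undirected multigraphs, loops allowed. The two ends of an edge are listed
   in an arbitrary order, which is ignored by everything below. *)
Record multigraph := Multigraph {
  vert : Type;
  edge : Type;
  ends : edge -> vert * vert
}.

Definition joins (G : multigraph) (e : edge G) (u v : vert G) : Prop :=
  ends e = (u, v) \/ ends e = (v, u).

Fixpoint within (G : multigraph) (u : vert G) (n : nat) (v : vert G) : Prop :=
  if n is m.+1 then
    within u m v \/ exists w e, within u m w /\ joins (G := G) e w v
  else v = u.

Definition connected_graph (G : multigraph) : Prop :=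
  inhabited (vert G) /\ forall u v : vert G, exists n, within u n v.

(* [ordS] is the cyclic successor; a cycle of length 1 is a loop and a cycle of
   length 2 is a pair of parallel edges. *)
Definition has_cycle (G : multigraph) : Prop :=
  exists (k : nat) (v : 'I_k.+1 -> vert G) (e : 'I_k.+1 -> edge G),
    [/\ injective v, injective e & forall i, joins (e i) (v i) (v (ordS i))].

Definition is_tree (G : multigraph) : Prop :=
  connected_graph G /\ ~ has_cycle G.

(* Degrees count half-edges, so that a loop contributes 2. *)
Definition half_edges (G : multigraph) (v : vert G) : set (edge G * bool) :=
  [set h | (if h.2 then (ends h.1).1 else (ends h.1).2) = v].

Definition regular (k : nat) (G : multigraph) : Prop :=
  forall v : vert G, (half_edges v #= `I_k)%card.

(* Unique up to isomorphism. *)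
Definition is_regular_tree (k : nat) (G : multigraph) : Prop :=
  is_tree G /\ regular k G.

Definition graph_hom (G H : multigraph)
    (f : vert G -> vert H) (h : edge G -> edge H) : Prop :=
  forall e, joins (h e) (f (ends e).1) (f (ends e).2).

Definition embeds (G H : multigraph) : Prop :=
  exists (f : vert G -> vert H) (h : edge G -> edge H),
    [/\ injective f, injective h & graph_hom f h].

Definition isomorphic (G H : multigraph) : Prop :=
  exists (f : vert G -> vert H) (h : edge G -> edge H),
    [/\ bijective f, bijective h & graph_hom f h].

(* The subgraph induced on the vertices at distance at most [r] from [v]. *)
Definition ball_graph (G : multigraph) (v : vert G) (r : nat) : multigraph :=
  @Multigraph {w : vert G | within v r w}
    {e : edge G | within v r (ends e).1 /\ within v r (ends e).2}
    (fun e => (exist _ (ends (sval e)).1 (proj1 (svalP e)),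
               exist _ (ends (sval e)).2 (proj2 (svalP e)))).

(* The balls are compared as unrooted graphs, and radii need not agree. *)
Definition locally_isomorphic (G H : multigraph) : Prop :=
  (forall (v : vert G) (r : nat), exists (w : vert H) (s : nat),
     isomorphic (ball_graph v r) (ball_graph w s)) /\
  (forall (w : vert H) (s : nat), exists (v : vert G) (r : nat),
     isomorphic (ball_graph v r) (ball_graph w s)).

Definition schreier (d : nat) (F : groupType) (X : 'I_d -> F) (Gam : chain F)
    (x : boundary Gam) : multigraph :=
  @Multigraph {y : boundary Gam | borbit x y} ({y | borbit x y} * 'I_d)%type
    (fun e => (e.1, exist _ (bact (sval e.1) (X e.2))
                      (orbit_bact (X e.2) (svalP e.1)))).

(* Main.v *)
Require Import Defs.
From HB Require Import structures.
From mathcomp Require Import all_boot all_order all_algebra zify lra.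
From mathcomp Require Import all_classical all_reals all_analysis.

(** Every subgroup of the chain is the kernel of a parity count on the previous
    one. The Schreier graph of Gamma_n is a finite quotient of the Cayley tree
    of F; an edge e_n of it is chosen, and Gamma_(n+1) consists of the elements
    of Gamma_n whose closed path runs an even number of times through e_n. The
    next Schreier graph is thus the double cover in which only the closed paths
    that cross e_n an odd number of times are opened.

    For n >= 2 the edge lies on a shortest nontrivial closed path at the base
    vertex and is crossed there an odd number of times ([minimal_loop]). Every
    element of F is therefore lost at some stage, and the intersection is
    trivial ([chain_edges_exist]). Hence the base ray has trivial stabilizer,
    and so have all points of its orbit, which is dense. The fixed points of a
    nontrivial element form a closed set that misses this orbit, so it is
    nowhere dense, and a comeager set of points has trivial stabilizer
    ([comeager_trivial_stabilizer]). The orbits of these points are copies of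
    the Cayley graph, which is a tree ([schreier_acyclic]).

    For the measure, fix two basis elements [X a] and [X b]. Only one edge is
    opened at stage n, and it starts at one of the 2^n vertices, so the
    proportion of vertices carrying a loop labelled [a] drops by at most 2^-n;
    it does not drop for n < 2, where the edge is labelled [b]. In the limit
    [X a] fixes a set of measure at least 1/2 ([measure_fixed_points]). The
    points whose orbit meets this set form an invariant set, which has measure
    1 by ergodicity ([boundary_zero_one]): their Schreier graphs contain a loop
    ([ae_loop]).

    The properties of the Cayley tree are all drawn from one fact: every
    function to Z/2 on its edges is the coboundary of a function on its
    vertices ([potential]). *)

Set Implicit Arguments.
Unset Strict Implicit.
Unset Printing Implicit Defensive.

Local Open Scope classical_set_scope.
Local Open Scope group_scope.

(** * Potentials on the Cayley graph of a free group *)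

(** The unrestricted wreath product of Z/2 by [F], the functions [F -> bool]
    being added pointwise. Homomorphisms to it that lift the identity of [F]
    are the cocycles on [F] with values in these functions. *)
Definition lamp (F : groupType) : Type := ((F -> bool) * F)%type.

Section Lamp.
Variable F : groupType.

HB.instance Definition _ := gen_eqMixin (lamp F).
HB.instance Definition _ := gen_choiceMixin (lamp F).

Definition lamp_one : lamp F := (fun=> false, 1).
Definition lamp_inv (u : lamp F) : lamp F :=
  (fun x => u.1 (x * u.2^-1), u.2^-1).
Definition lamp_mul (u v : lamp F) : lamp F :=
  (fun x => u.1 x (+) v.1 (x * u.2), u.2 * v.2).

Lemma lamp_mulA : associative lamp_mul.
Proof.
move=> [f a] [g b] [h c]; congr pair => /=; last by rewrite mulgA.
by apply/funext => x; rewrite addbA mulgA.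
Qed.

Lemma lamp_mul1 : left_id lamp_one lamp_mul.
Proof.
move=> [f a]; congr pair => /=; last by rewrite mul1g.
by apply/funext=> x; rewrite mulg1.
Qed.

Lemma lamp_mulr1 : right_id lamp_one lamp_mul.
Proof.
move=> [f a]; congr pair => /=; last by rewrite mulg1.
by apply/funext=> x; rewrite addbF.
Qed.

Lemma lamp_mulV : left_inverse lamp_one lamp_inv lamp_mul.
Proof.
move=> [f a]; congr pair => /=; last by rewrite mulVg.
by apply/funext=> x; rewrite addbb.
Qed.

Lemma lamp_mulrV : right_inverse lamp_one lamp_inv lamp_mul.
Proof.
move=> [f a]; congr pair => /=; last by rewrite mulgV.
by apply/funext=> x; rewrite mulgK addbb.
Qed.

HB.instance Definition _ := isGroup.Build (lamp F)
  lamp_mulA lamp_mul1 lamp_mulr1 lamp_mulV lamp_mulrV.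

End Lamp.

Section FreeBasis.
Variables (d : nat) (F : groupType) (X : 'I_d -> F).
Hypothesis hX : free_basis X.

Lemma hom_ext (G : groupType) (f g : F -> G) :
  {morph f : x y / x * y} -> {morph g : x y / x * y} ->
  (forall i, f (X i) = g (X i)) -> f = g.
Proof.
move=> fM gM fg; have [h [_ hu]] := hX (f \o X).
by rewrite -(hu f) // -(hu g) //; split => // i; rewrite -fg.
Qed.

(** A free basis generates. The conjugate of the trivial lift [F -> lamp F] by
    the indicator function of [P] agrees with the trivial lift on the basis when
    [P] is stable under right multiplication by the basis and its inverses; by
    uniqueness in the universal property both lifts are equal, so that [P] is
    invariant under all right translations. *)
Lemma basis_ind (P : F -> Prop) :
  P 1 -> (forall x l, P x <-> P (x * X l)) -> forall g, P g.
Proof.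
move=> P1 PX g; pose f g : lamp F := (fun=> false, g).
pose c g : lamp F := (fun x => `[< P x >] (+) `[< P (x * g) >], g).
have fc : f = c.
  apply: hom_ext => [x y|x y|l]; rewrite /f /c; congr pair => /=.
  - by apply/funext => z; rewrite mulgA addbA addbK.
  - by apply/funext => z; rewrite (asbool_equiv_eq (PX z l)) addbb.
have := congr1 (fun h => (h g).1 1) fc; rewrite /= mul1g.
by rewrite (asboolT P1) /=; case: asboolP.
Qed.

Variable E : F -> 'I_d -> bool.

(** The labels [E _ l], paired with [X l], extend to a homomorphism to the wreath
    product; its first component, read at the identity, is the parity of the
    number of edges of [E] crossed by a path from the identity. *)
Lemma potential_exists :
  exists phi : F -> bool, phi 1 = false /\
    forall g l, phi (g * X l) = phi g (+) E g l.
Proof.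
have [f [[fM fX] _]] := hX (fun l => (E^~ l, X l) : lamp F).
have f2 : (fun g => (f g).2) = id.
  by apply: hom_ext => // [x y|l]; rewrite ?fM ?fX.
have f2E g : (f g).2 = g by rewrite -[RHS]/(id g) -f2.
exists (fun g => (f g).1 1); split=> [|g l].
  have := fM 1 1; rewrite mulg1 => /(congr1 (fun u => u.1 1)) /=.
  by rewrite f2E mulg1; case: (_.1 1).
by rewrite fM fX /= f2E mul1g.
Qed.

(** The edges of the Cayley graph are the pairs [(g, l)], joining [g] and
    [g * X l]; [potential] is the primitive of [E] that vanishes at the
    identity. *)
Definition potential : F -> bool := projT1 (cid potential_exists).

Lemma potential1 : potential 1 = false.
Proof. by rewrite /potential; case: cid => /= f []. Qed.

Lemma potentialX g l : potential (g * X l) = potential g (+) E g l.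
Proof. by rewrite /potential; case: cid => /= f []. Qed.

(** If [E] is invariant under left translation by [H], then both sides have the
    same increments along the edges. In particular the potential restricts to a
    homomorphism from [H] to Z/2. *)
Lemma potential_subgroup (H : set F) :
  (forall x g l, H x -> E (x * g) l = E g l) ->
  forall x g, H x -> potential (x * g) = potential x (+) potential g.
Proof.
move=> EH x g Hx; elim/basis_ind: g => [|g l].
  by rewrite mulg1 potential1 addbF.
rewrite mulgA !potentialX EH // addbA; split=> [->//|].
by move/(congr1 (addb^~ (E g l))); rewrite !addbK.
Qed.

End FreeBasis.

(** * Short loops modulo a subgroup *)

Section Words.
Variables (d : nat) (F : groupType) (X : 'I_d -> F).
Hypothesis hX : free_basis X.
Local Notation letter := ('I_d * bool)%type.
Implicit Types (w : seq letter) (g x y t : F) (H : set F).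

Definition letter_val (a : letter) : F := if a.2 then X a.1 else (X a.1)^-1.

Definition word_val w : F := \prod_(a <- w) letter_val a.

Lemma word_val_surj g : exists w, word_val w = g.
Proof.
elim/(basis_ind hX): g => [|g l].
  by exists [::]; rewrite /word_val big_nil.
split=> -[w wE].
  by exists (rcons w (l, true)); rewrite /word_val big_rcons -/(word_val w) wE.
exists (rcons w (l, false)).
by rewrite /word_val big_rcons -/(word_val w) wE /= /letter_val /= mulgK.
Qed.

(** The edge labelled [l] at the vertex [H t] of the Schreier graph of [H],
    lifted to the Cayley graph. *)
Definition coset_edge H t l : F -> 'I_d -> bool :=
  fun x m => (m == l) && `[< H (x * t^-1) >].

Lemma coset_edgeM H t l x g m :
  is_subgroup H -> H x -> coset_edge H t l (x * g) m = coset_edge H t l g m.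
Proof.
move=> [H1 HM HV] Hx; rewrite /coset_edge -mulgA; congr andb.
apply/asboolP/asboolP => [h|]; last exact: HM.
by rewrite -[_ * _](mulKg x); apply: HM => //; apply: HV.
Qed.

(** In a shortest word [w] over [S] for a nontrivial element of [H], consider a
    shortest nonempty segment whose two ends lie in the same coset of [H].
    Deleting the segment gives a shorter word for an element of [H], which must
    be trivial; so [word_val w] is the segment conjugated by its initial part,
    and it has the parity of the segment. The segment is a simple closed path in
    the Schreier graph and does not consist of an edge followed by its inverse,
    for then [word_val w] would be trivial. Its first edge is crossed once. *)
Lemma minimal_loop (S : pred 'I_d) H w0 : is_subgroup H ->
  all (fun a => S a.1) w0 -> H (word_val w0) -> word_val w0 <> 1 ->
  exists w t l,
    [/\ S l, H (word_val w), word_val w <> 1,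
      (forall w', all (fun a => S a.1) w' -> H (word_val w') ->
         word_val w' <> 1 -> size w <= size w') &
      potential hX (coset_edge H t l) (word_val w)].
Proof.
move=> Hsub Sw0 Hw0 w0N1; have [H1 HM HV] := Hsub.
pose loop w := [/\ all (fun a => S a.1) w, H (word_val w) & word_val w <> 1].
have exn : exists n, `[< exists2 w, loop w & size w = n >].
  by exists (size w0); apply/asboolP; exists w0.
case: (ex_minnP exn) => n /asboolP[w [Sw Hw wN1] sw] wmin.
have {}wmin w' : loop w' -> size w <= size w'.
  by move=> lw'; rewrite sw; apply: wmin; apply/asboolP; exists w'.
pose p k := word_val (take k w).
have p0 : p 0 = 1 by rewrite /p take0 /word_val big_nil.
have pn : p n = word_val w by rewrite /p -sw take_size.
have n0 : 0 < n.
  by rewrite lt0n; apply/eqP => n0; move: wN1; rewrite -pn n0 p0.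
have [a0 _] : exists a : letter, True.
  by case: (w) sw => [/= n00|b s _]; [rewrite -n00 in n0|exists b].
pose a k := nth a0 w k.
have pS k : k < n -> p k.+1 = p k * letter_val (a k).
  by move=> kn; rewrite /p (take_nth a0) ?sw // /word_val big_rcons.
have exm : exists m, (0 < m) &&
    `[< exists2 i, i + m <= n & H (p (i + m) * (p i)^-1) >].
  exists n; rewrite n0; apply/asboolP; exists 0 => //.
  by rewrite add0n pn p0 invg1 mulg1.
case: (ex_minnP exm) => m /andP[m0 /asboolP[i imn Hi]] mmin.
have far k k' : i <= k -> k < k' -> k' <= i + m -> k' - k < m ->
    ~ H (p k' * (p k)^-1).
  move=> ik kk' k'm lt_m Hk; suff : m <= k' - k by lia.
  apply: mmin; rewrite subn_gt0 kk'; apply/asboolP; exists k; first by lia.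
  by rewrite subnKC // ltnW.
(* The word without the segment evaluates in [H] and is shorter than [w]. *)
have wE : word_val w = p (i + m) * (p i)^-1.
  have wv : word_val w = p (i + m) * word_val (drop (i + m) w).
    by rewrite /p /word_val -big_cat /= cat_take_drop.
  have cut : word_val (take i w ++ drop (i + m) w) =
      (p (i + m) * (p i)^-1)^-1 * word_val w.
    by rewrite /word_val big_cat -/(word_val _) wv invgF -mulgA mulKg.
  apply/esym/(mulgI (p (i + m) * (p i)^-1)^-1); rewrite mulVg -cut.
  apply: esym; apply: contrapT => cutN1.
  suff : size w <= size (take i w ++ drop (i + m) w).
    by rewrite size_cat size_takel ?size_drop sw; lia.
  apply: wmin; split => //; last by rewrite cut; apply: HM => //; apply: HV.
  rewrite all_cat; apply/andP; split; apply/allP => b.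
    by move/mem_take/(allP Sw).
  by move/mem_drop/(allP Sw).
have aS k : k < n -> S (a k).1.
  by move=> kn; apply: (allP Sw); rewrite mem_nth ?sw.
pose src k := if (a k).2 then p k else p k.+1.
pose E := coset_edge H (src i) (a i).1; pose phi := potential hX E.
have phiS k : k < n -> phi (p k.+1) = phi (p k) (+) E (src k) (a k).1.
  move=> kn; have := pS k kn; rewrite /src /letter_val.
  case: (a k).2 => [->|pk]; first exact: potentialX.
  have -> : p k = p k.+1 * X (a k).1 by rewrite pk mulgVK.
  by rewrite /phi potentialX addbK.
have Ei : E (src i) (a i).1.
  by rewrite /E /coset_edge eqxx mulgV; apply/asboolP.
(* A second crossing of the edge would make two vertices of the segment agree
   modulo [H], or reduce it to an edge followed by its inverse. *)
have Ek k : i < k -> k < i + m -> E (src k) (a k).1 = false.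
  move=> ik kim; apply/negbTE/negP; rewrite /E /coset_edge.
  case/andP=> /eqP akl /asboolP; rewrite /src.
  have pi1 := pS i ltac:(lia); have pk1 := pS k ltac:(lia).
  move: pi1 pk1; rewrite /letter_val akl.
  case: (a i).2; case: (a k).2 => pi1 pk1 Hk.
  - by apply: far Hk; lia.
  - have Hk' : H (p k * (p i.+1)^-1).
      by rewrite pi1 invgM mulgA; rewrite pk1 in Hk.
    have ki : k = i.+1 by apply/eqP/negPn/negP => ne; apply: far Hk'; lia.
    have pik : p k.+1 = p i by rewrite pk1 ki pi1 mulgK.
    have [km|km] := eqVneq k.+1 (i + m).
      by apply: wN1; rewrite wE -km pik mulgV.
    by apply: (far i k.+1) Hk; lia.
  - have ki : k = i.+1 by apply/eqP/negPn/negP => ne; apply: far Hk; lia.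
    have pik : p k.+1 = p i by rewrite pk1 ki pi1 mulgVK.
    have [km|km] := eqVneq k.+1 (i + m).
      by apply: wN1; rewrite wE -km pik mulgV.
    by apply: (far i k.+1); rewrite ?pik ?mulgV //; lia.
  - by apply: far Hk; lia.
have phim k : k < m -> phi (p (i + k.+1)) = ~~ phi (p i).
  elim: k => [|k IH] km.
    by rewrite addn1 phiS ?Ei ?addbT //; lia.
  by rewrite addnS phiS ?Ek ?addbF ?IH //; lia.
exists w, (src i), (a i).1; split => //; first by apply: aS; lia.
  by move=> w' ? ? ?; apply: wmin.
have EH x g l : H x -> E (x * g) l = E g l by move=> ?; apply: coset_edgeM.
have := potential_subgroup hX EH (p i) Hw.
rewrite {1}wE mulgVK -/E -/phi -(prednK m0) phim ?prednK //.
by case: (phi (p i)); case: (phi _).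
Qed.

(** Along the powers of [X l] up to the smallest trivial one, the edge labelled
    [l] at the identity would be crossed exactly once. *)
Lemma expg_basis_neq1 l n : 0 < n -> X l ^+ n <> 1.
Proof.
move=> n0 Xn; have exn : exists n, (0 < n) && (X l ^+ n == 1).
  by exists n; rewrite n0 Xn eqxx.
case: (ex_minnP exn) => {n n0 Xn exn}m /andP[m0 /eqP Xm] mmin.
pose phi := potential hX (coset_edge [set 1] 1 l).
suff phiX k : k < m -> phi (X l ^+ k.+1) = true.
  by have := phiX m.-1; rewrite prednK // Xm /phi potential1 => /(_ ltac:(lia)).
elim: k => [|k IH] km.
  rewrite expg1 -[X l]mul1g /phi potentialX potential1 /coset_edge eqxx.
  by rewrite mulgV; apply/asboolP.
rewrite expgSr /phi potentialX -/phi IH; last by lia.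
rewrite /coset_edge eqxx invg1 mulg1 /=; case: asboolP => //= Xk.
by have := mmin k.+1; rewrite Xk eqxx /= => /(_ isT); lia.
Qed.

End Words.

(** * Cutting loops by subgroups of index two *)

Section ChainConstruction.
Variables (d : nat) (F : groupType) (X : 'I_d -> F).
Hypothesis hX : free_basis X.
Variable b : 'I_d.
Implicit Types (H : set F) (g x y t : F).

Definition even_part H (e : F * 'I_d) : set F :=
  [set x | H x /\ ~~ potential hX (coset_edge H e.1 e.2) x].

Lemma coset_potentialM H e x g : is_subgroup H -> H x ->
  potential hX (coset_edge H e.1 e.2) (x * g) =
  potential hX (coset_edge H e.1 e.2) x (+)
  potential hX (coset_edge H e.1 e.2) g.
Proof.
move=> Hsub; apply: (@potential_subgroup d F X hX _ H) => y h m Hy.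
exact: coset_edgeM.
Qed.

Lemma even_part_subgroup H e : is_subgroup H -> is_subgroup (even_part H e).
Proof.
move=> Hsub; have [H1 HM HV] := Hsub; split=> [|x y [Hx px] [Hy py]|x [Hx px]].
- by split=> //; rewrite potential1.
- by split; [exact: HM|rewrite coset_potentialM // (negbTE px)].
- split; [exact: HV|]; have := coset_potentialM e x^-1 Hsub Hx.
  by rewrite mulgV potential1 (negbTE px) /= => /esym/negbT.
Qed.

(** The requirements on the edge opened at stage [n]: some element of [H] is
    lost, for [n >= 2] it is among the shortest ones, and for [n < 2] the label
    is [b], so that no loop with another label is opened. *)
Definition good_edge n H (e : F * 'I_d) : Prop :=
  (n < 2 -> e.2 = b) /\
  exists w, [/\ H (word_val X w),
      potential hX (coset_edge H e.1 e.2) (word_val X w) &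
      2 <= n -> forall g, H g -> g <> 1 ->
        forall w', word_val X w' = g -> size w <= size w'].

(** The shortest loop is sought among the words in [b] alone when [n < 2], and
    among all words otherwise; a power of [X b] guarantees that there is one. *)
Lemma good_edge_exists n H k : is_subgroup H -> 0 < k -> H (X b ^+ k) ->
  exists e, good_edge n H e.
Proof.
move=> Hsub k0 Hk; pose w0 := nseq k (b, true).
have w0E : word_val X w0 = X b ^+ k.
  by rewrite /word_val big_nseq iter_mulg_1.
have w0N1 : word_val X w0 <> 1 by rewrite w0E; apply: expg_basis_neq1.
pose S m : pred 'I_d := if m < 2 then pred1 b else predT.
have Sw0 : all (fun a => S n a.1) w0.
  by rewrite all_nseq /S; case: ifP => _ /=; rewrite ?eqxx orbT.
have Hw0 : H (word_val X w0) by rewrite w0E.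
have [w [t [l [Sl Hw _ wmin pw]]]] := minimal_loop hX Hsub Sw0 Hw0 w0N1.
exists (t, l); split.
  by move=> n2; move: Sl; rewrite /S n2 => /eqP.
exists w; split=> // n2 g Hg gN1 w' w'E; apply: wmin; rewrite ?w'E //.
by rewrite /S ltnNge n2 /=; apply/allP.
Qed.

Lemma bounded_words_repeat (w : nat -> seq ('I_d * bool)) L :
  (forall n, size (w n) <= L) -> exists n m, n < m /\ w n = w m.
Proof.
move=> wL; apply: contrapT => wN; pose T := {bseq L of 'I_d * bool}.
pose f (i : 'I_(#|{: T}|.+1)) : T := Bseq (wL i).
have : injective f.
  move=> i j /(congr1 val) /= wij; apply/val_inj => /=.
  by have [ij|ij|//] := ltngtP i j; case: wN; [exists i, j|exists j, i].
by move/leq_card; rewrite card_ord ltnn.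
Qed.

(** A nontrivial element of the intersection would bound the length of the
    words [w n] that witness [good_edge] for [n >= 2]. These words are pairwise
    distinct, since [w n] evaluates in [G n] but not in [G n.+1], and there are
    only finitely many words of bounded length. *)
Lemma chain_edges_exist : exists (G : nat -> set F) (e : nat -> F * 'I_d),
  [/\ G 0 = setT, forall n, is_subgroup (G n),
    forall n, G n.+1 = even_part (G n) (e n),
    forall n, good_edge n (G n) (e n) &
    \bigcap_n G n = [set 1]].
Proof.
have stepP (p : nat * set F) : exists e, is_subgroup p.2 ->
    (exists2 k, 0 < k & p.2 (X b ^+ k)) -> good_edge p.1 p.2 e.
  case: (pselect (is_subgroup p.2 /\ exists2 k, 0 < k & p.2 (X b ^+ k))).
    case=> Hsub [k k0 Hk].
    by have [e] := good_edge_exists p.1 Hsub k0 Hk; exists e.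
  by move=> N; exists (1, b) => ? ?; case: N.
have [step {}stepP] := choice stepP.
pose G := fix G n :=
  if n is m.+1 then even_part (G m) (step (m, G m)) else setT.
pose e n := step (n, G n).
have Gsub n : is_subgroup (G n).
  by elim: n => [|n IH]; [split|exact: even_part_subgroup].
have Gb n : exists2 k, 0 < k & G n (X b ^+ k).
  elim: n => [|n [k k0 Gk]]; first by exists 1%N.
  have [_ GM _] := Gsub n.
  exists (k + k); first by rewrite addn_gt0 k0.
  by rewrite expgnDr; split; [exact: GM|rewrite coset_potentialM // addbb].
have Ge n : good_edge n (G n) (e n) := stepP (n, G n) (Gsub n) (Gb n).
have Gdecr m n : m <= n -> G n `<=` G m.
  move/subnKC <-; elim: (n - m) => [|k IH]; first by rewrite addn0.
  by rewrite addnS => x [/IH].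
exists G, e; split=> //; apply/seteqP; split; last first.
  by move=> _ -> n _; case: (Gsub n).
move=> g Gg; apply: contrapT => gN1; have [w0 w0E] := word_val_surj hX g.
have [w wP] := choice (fun n => (Ge n).2).
have wsize n : size (w n.+2) <= size w0.
  by have [_ _ /(_ isT g)] := wP n.+2; apply => //; apply: Gg.
have [n [m [nm wnm]]] := bounded_words_repeat wsize.
have [_ pn _] := wP n.+2; have [Gm _ _] := wP m.+2.
have [] : G n.+3 (word_val X (w m.+2)) by apply: Gdecr Gm.
by rewrite -/(G n.+2) -wnm -/(e n.+2) pn.
Qed.

End ChainConstruction.

Lemma basis_countable (d : nat) (F : groupType) (X : 'I_d -> F) :
  free_basis X -> exists en : nat -> F, forall g, exists n, en n = g.
Proof.
move=> hX; exists (fun n => word_val X (odflt [::] (unpickle n))) => g.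
by have [w wg] := word_val_surj hX g; exists (pickle w); rewrite pickleK.
Qed.

(** * Boundary of a coset tree *)

Section CosetTreeFacts.
Variables (F : groupType) (Gam : chain F).
Implicit Types (v : vertex Gam) (x y : boundary Gam) (g h : F).
Implicit Types (U : set (boundary Gam)).

Lemma translate_eq (H : set F) g h : is_subgroup H ->
  translate H g = translate H h <-> H (g * h^-1).
Proof.
move=> Hsub; have [H1 HM HV] := Hsub; split=> [e|Hgh].
  have : translate H g g by exists 1; rewrite ?mul1g.
  by rewrite e => -[k Hk <-]; rewrite mulgK.
apply: right_coset_eq Hsub _ _; first by exists g.
by exists (g * h^-1)^-1; [exact: HV|rewrite invgF mulgVK].
Qed.

Lemma vertex_of_eq n g h :
  vertex_of Gam n g = vertex_of Gam n h <-> Gam n (g * h^-1).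
Proof.
rewrite -translate_eq; last exact: chain_subgroup.
by split=> [/(congr1 (@coset_of_vertex _ _))//|e]; apply: vertex_eq.
Qed.

Lemma vertex_ofE v : exists g, v = vertex_of Gam (level v) g.
Proof. by have [g _ gv] := vertexP v; exists g; apply: vertex_eq. Qed.

Lemma rayE x n : exists g, x n = vertex_of Gam n g.
Proof. by have [g] := vertex_ofE (x n); rewrite ray_level; exists g. Qed.

Lemma vact_vertex_of n g h :
  vact (vertex_of Gam n g) h = vertex_of Gam n (g * h).
Proof. by apply: vertex_eq => //=; rewrite translateM. Qed.

Lemma shadowP v x : shadow v x <-> x (level v) = v.
Proof.
by split=> [[n xn]|]; [rewrite -[in level v]xn ray_level|exists (level v)].
Qed.

Lemma shadow_open v : open (shadow v).
Proof. by exists [set v] => //; rewrite bigcup_set1. Qed.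

Lemma open_shadow U x : open U -> U x -> exists n, shadow (x n) `<=` U.
Proof.
case=> D _ DU; rewrite -{}DU => -[v Dv [n xn]].
by exists n => y xny; exists v => //; rewrite -xn.
Qed.

Lemma bact1 x : bact x 1 = x.
Proof. by apply: ray_eq => n /=; rewrite vact1. Qed.

Lemma bactK x g : bact (bact x g) g^-1 = x.
Proof. by rewrite bactM mulgV bact1. Qed.

Lemma shadow_bact v x g : shadow (vact v g) (bact x g) <-> shadow v x.
Proof. by rewrite !shadowP /=; split=> [/vact_inj|->]. Qed.

Lemma spherically_transitive_coset_tree : spherically_transitive Gam.
Proof.
move=> n u v un vn; have [g ->] := vertex_ofE u; have [h ->] := vertex_ofE v.
by exists (g^-1 * h); rewrite vact_vertex_of mulgA mulgV mul1g un vn.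
Qed.

Definition fixed_points g : set (boundary Gam) := [set x | bact x g = x].

Lemma fixed_points_closed g : closed (fixed_points g).
Proof.
rewrite -openC; pose D := [set v | forall y, shadow v y -> bact y g <> y].
exists D => //; apply/seteqP; split=> [x [v Dv]|x xg]; first exact: Dv.
have [n xn] : exists n, vact (x n) g <> x n.
  apply: contrapT => N; apply: xg; apply: ray_eq => n /=.
  by apply: contrapT => xn; apply: N; exists n.
exists (x n); last by exists n.
move=> y [m ym]; have mn : m = n by rewrite -(ray_level y m) ym ray_level.
by move=> /(congr1 (fun z : boundary Gam => z m)) /=; rewrite ym => /xn.
Qed.

(** A shadow contains a translate of the base ray, whose stabilizer is a
    conjugate of the intersection of the chain. *)
Lemma fixed_points_nowhere_dense g : \bigcap_n Gam n = [set 1] -> g <> 1 ->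
  nowhere_dense (fixed_points g).
Proof.
move=> capG gN1; rewrite /nowhere_dense.
rewrite -((closure_id (fixed_points g)).1 (@fixed_points_closed g)).
apply/seteqP; split=> // x xint.
have [n sub] := open_shadow (@open_interior _ (fixed_points g)) xint.
have [h xn] := rayE x n.
have : fixed_points g (bact (base_ray Gam) h).
  apply: interior_subset; apply: sub; exists n => /=.
  by rewrite vact_vertex_of mul1g xn.
rewrite /fixed_points /= => fixh.
have : (\bigcap_n Gam n) (h * g * h^-1).
  move=> m _; apply/vertex_of_eq.
  have := congr1 (fun z : boundary Gam => z m) fixh.
  by rewrite /= !vact_vertex_of mul1g.
rewrite capG => /divg1_eq hgh; apply: gN1; apply: (@mulgI _ h).
by rewrite hgh mulg1.
Qed.

End CosetTreeFacts.

Lemma comeager_trivial_stabilizer (F : groupType) (Gam : chain F)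
    (en : nat -> F) :
  (forall g, exists n, en n = g) -> \bigcap_n Gam n = [set 1] ->
  comeager [set x : boundary Gam | stabilizer x = [set 1]].
Proof.
move=> enE capG.
exists (fun n => if en n == 1 then set0 else fixed_points (en n)); split.
  move=> n; case: eqP => [_|nN1]; last first.
    by split; [exact: fixed_points_closed|exact: fixed_points_nowhere_dense].
  by split; [exact: closed0|rewrite /nowhere_dense closure0 interior0].
apply/seteqP; split=> [x /= stab1 [n _]|x xn /=].
  case: eqP => // nN1 xn; apply: nN1.
  by have : stabilizer x (en n) by []; rewrite stab1.
apply/seteqP; split=> [g xg|_ ->]; last exact: bact1.
apply: contrapT => gN1; apply: xn; have [n ng] := enE g; exists n => //.
by rewrite ng; case: eqP.
Qed.

(** * Loops and cycles in multigraphs *)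

Lemma loop_cycle (G : multigraph) (e : edge G) (v : vert G) :
  ends e = (v, v) -> has_cycle G.
Proof.
move=> ev; exists 0, (fun=> v), (fun=> e).
by split=> [i j _|i j _|i]; rewrite ?ord1 ?[j]ord1 //; left.
Qed.

(** The ball of radius 0 already contains every loop at its centre. *)
Lemma loop_ball_not_embeds (G T : multigraph) (e : edge G) (v : vert G) :
  ends e = (v, v) -> ~ has_cycle T -> ~ embeds (ball_graph v 0) T.
Proof.
move=> ev Tac [f [h [_ _ fh]]]; apply: Tac.
have be : Defs.within v 0 (ends e).1 /\ Defs.within v 0 (ends e).2.
  by rewrite ev.
have := fh (exist _ e be); rewrite /joins /=.
set p := f _; set q := f _; have -> : q = p.
  by congr f; apply: eq_exist; rewrite ev.
by case=> pp; apply: (loop_cycle pp).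
Qed.

Lemma not_locally_isomorphic_loop (G H : multigraph) (e : edge H) (w : vert H) :
  ~ has_cycle G -> ends e = (w, w) -> ~ locally_isomorphic G H.
Proof.
move=> Gac ew [_ /(_ w 0)[v [r [f [h [[f' fK _] [h' _ hK] fh]]]]]]; apply: Gac.
have be : Defs.within w 0 (ends e).1 /\ Defs.within w 0 (ends e).2.
  by rewrite ew.
pose e' := exist _ e be : edge (ball_graph w 0).
have := fh (h' e'); rewrite hK /joins /= => ff.
have : f (ends (h' e')).1 = f (ends (h' e')).2.
  have ee : (ends e').1 = (ends e').2 by apply: eq_exist; rewrite ew.
  by move: ee; rewrite /e' /=; case: ff => -[-> ->].
move=> /(can_inj fK) /(congr1 sval) /= eends.
apply: (@loop_cycle G (sval (h' e')) (ends (sval (h' e'))).1).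
by rewrite [X in _ = (_, X)]eends; case: ends.
Qed.

(** * Schreier graphs of boundary orbits *)

Section Schreier.
Variables (d : nat) (F : groupType) (X : 'I_d -> F).
Hypothesis hX : free_basis X.
Variable Gam : chain F.
Implicit Types (x y : boundary Gam) (g : F).

Definition orbit_point x g : vert (schreier X x) :=
  exist _ (bact x g) (imageT (bact x) g).

Lemma orbit_pointP x (u : vert (schreier X x)) : exists g, u = orbit_point x g.
Proof. by case: u => y p; have [g _ yE] := p; exists g; apply: eq_exist. Qed.

Lemma schreier_ends x g l :
  ends (m := schreier X x) (orbit_point x g, l) =
  (orbit_point x g, orbit_point x (g * X l)).
Proof. by congr pair; apply: eq_exist; rewrite /= bactM. Qed.

Lemma joins_sym (G : multigraph) (e : edge G) u v : joins e u v -> joins e v u.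
Proof. by case; [right|left]. Qed.

Lemma schreier_connected x : connected_graph (schreier X x).
Proof.
split; first exact: inhabits (orbit_point x 1).
move=> u v; have [g ->] := orbit_pointP u; have [h ->] := orbit_pointP v.
rewrite -[h](mulVKg g); elim/(basis_ind hX): (g^-1 * h) => [|k l].
  by exists 0; rewrite mulg1.
rewrite mulgA; have j : joins (G := schreier X x) (orbit_point x (g * k), l)
    (orbit_point x (g * k)) (orbit_point x (g * k * X l)).
  by left; apply: schreier_ends.
split=> -[n wn]; exists n.+1; right.
  by exists (orbit_point x (g * k)), (orbit_point x (g * k), l).
exists (orbit_point x (g * k * X l)), (orbit_point x (g * k), l).
by split=> //; apply: joins_sym.
Qed.

Lemma schreier_regular x : regular (2 * d) (schreier X x).
Proof.
move=> v; have [g ->] := orbit_pointP v.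
pose f (a : 'I_d * bool) : edge (schreier X x) * bool :=
  ((orbit_point x (if a.2 then g else g * (X a.1)^-1), a.1), a.2).
have finj : injective f by move=> [l s] [l' s'] [] _ -> ->.
pose n := #|{: 'I_d * bool}|.
have -> : (2 * d)%N = n by rewrite /n card_prod card_ord card_bool mulnC.
have -> : half_edges (orbit_point x g) =
    (fun i : 'I_n => f (enum_val i)) @` setT.
  have -> : (fun i : 'I_n => f (enum_val i)) @` setT = f @` setT.
    apply/seteqP; split=> [_ [i _ <-]|_ [a _ <-]]; first by exists (enum_val i).
    by exists (enum_rank a); rewrite ?enum_rankK.
  apply/seteqP; split=> [[[u l] s]|_ [[l s] _ <-]].
    rewrite /half_edges /=; case: s => /= [->|ug]; first by exists (l, true).
    exists (l, false) => //; congr (_, _, _); move: ug.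
    have [h ->] := orbit_pointP u => /(congr1 sval) /= ug.
    by apply: eq_exist; rewrite /= -bactM -ug bactK.
  rewrite /half_edges /f /=; case: s => //=. apply: eq_exist => /=.
  by rewrite bactM mulgVK.
apply: card_eq_trans (card_esym (card_II)).
by apply: inj_card_eq => i j _ _ /finj /enum_val_inj.
Qed.

(** The orbit is a copy of [F]. Along a cycle the potential of the single edge
    [e ord0] would change exactly once, yet return to its initial value. *)
Lemma schreier_acyclic x : stabilizer x = [set 1] -> ~ has_cycle (schreier X x).
Proof.
move=> stab1 [k [v [e [_ einj ve]]]].
have xinj g h : orbit_point x g = orbit_point x h -> g = h.
  move=> /(congr1 sval) /= gh; have : stabilizer x (g * h^-1).
    by rewrite /stabilizer /= -bactM gh bactK.
  by rewrite stab1 => /divg1_eq.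
pose E g l := `[< (orbit_point x g, l) = e ord0 >].
have [g gE] := choice (fun i => orbit_pointP (v i)).
pose phi := potential hX E.
have step i : phi (g (ordS i)) = phi (g i) (+) (i == ord0).
  have [h hE] := orbit_pointP (e i).1.
  have eE : e i = (orbit_point x h, (e i).2) by rewrite -hE; case: (e i).
  have Eh : E h (e i).2 = (i == ord0).
    by rewrite /E -eE; apply/asboolP/eqP => [/einj|->].
  have phih : phi (h * X (e i).2) = phi h (+) (i == ord0).
    by rewrite /phi potentialX Eh.
  have := ve i; rewrite /joins !gE eE schreier_ends.
  case=> e2; have hg := xinj _ _ (congr1 fst e2);
    have := xinj _ _ (congr1 snd e2); rewrite /= hg => hX'.
    by rewrite -hX' -hg.
  by rewrite -hX' -hg phih addbK.
have around j : j <= k -> phi (g (inord j)) = (j != 0) (+) phi (g ord0).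
  elim: j => [|j IH] jk.
    by rewrite (_ : inord 0 = ord0) //; apply/val_inj; rewrite /= inordK.
  have -> : inord j.+1 = ordS (inord j) :> 'I_k.+1.
    by apply/val_inj; rewrite /= !inordK ?modn_small //; lia.
  rewrite step IH; last by lia.
  rewrite -val_eqE /= inordK; last by lia.
  by case: (j) (phi _) => [|?] [].
have := step (inord k); rewrite around // -val_eqE /= inordK //.
have -> : ordS (inord k) = ord0 :> 'I_k.+1.
  by apply/val_inj; rewrite /= inordK // modnn.
by case: (k == 0)%N; case: (phi _).
Qed.

Lemma schreier_regular_tree x :
  stabilizer x = [set 1] -> is_regular_tree (2 * d) (schreier X x).
Proof.
move=> stab1; split; last exact: schreier_regular.
by split; [exact: schreier_connected|exact: schreier_acyclic].
Qed.

Lemma schreier_loop x g l : bact (bact x g) (X l) = bact x g ->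
  ends (m := schreier X x) (orbit_point x g, l) =
  (orbit_point x g, orbit_point x g).
Proof. by move=> fixl; congr pair; apply: eq_exist. Qed.

End Schreier.

(** * Chains whose steps have index two *)

Section IndexTwo.
Variables (F : groupType) (G : nat -> set F) (s : nat -> F).
Hypotheses (GT : G 0 = setT) (Gsub : forall n, is_subgroup (G n)).
Hypotheses (Gdecr : forall n, G n.+1 `<=` G n).
Hypotheses (Gs : forall n, G n (s n)) (NGs : forall n, ~ G n.+1 (s n)).
Hypothesis Gcover : forall n x, G n x -> G n.+1 x \/ G n.+1 (x * (s n)^-1).

(** For [k < 2 ^ n] these represent the right cosets of [G n], and the parent of
    the coset number [k] has number [k./2]: the binary digits of [k], from the
    most significant one, describe the path from the root. *)
Fixpoint coset_rep n k : F :=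
  if n is m.+1 then s m ^+ odd k * coset_rep m k./2 else 1.

Lemma coset_rep_half n k : G n (coset_rep n.+1 k * (coset_rep n k./2)^-1).
Proof.
have [G1 _ _] := Gsub n.
by rewrite /= mulgK; case: (odd k); rewrite ?expg1 ?expg0 //; apply: Gs.
Qed.

Lemma coset_rep_cover n g :
  exists2 k, k < 2 ^ n & G n (g * (coset_rep n k)^-1).
Proof.
elim: n => [|n [k kn Gk]]; first by exists 0 => //; rewrite GT.
have [Gk'|Gk'] := Gcover Gk; [exists k.*2|exists k.*2.+1].
- by rewrite expnS mul2n ltn_double.
- by rewrite /= odd_double doubleK expg0 mul1g.
- by rewrite expnS mul2n ltn_Sdouble.
- by rewrite /= odd_double uphalf_double expg1 invgM mulgA.
Qed.

Lemma coset_rep_inj n k k' : k < 2 ^ n -> k' < 2 ^ n ->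
  G n (coset_rep n k * (coset_rep n k')^-1) -> k = k'.
Proof.
elim: n k k' => [|n IH] k k' kn k'n Gkk'.
  by move: kn k'n; rewrite expn0 !ltnS !leqn0 => /eqP-> /eqP->.
have [_ GM GV] := Gsub n; have [_ _ GV1] := Gsub n.+1.
have half_lt m : m < 2 ^ n.+1 -> m./2 < 2 ^ n.
  by rewrite expnS mul2n => ?; rewrite ltn_half_double.
have kk2 : k./2 = k'./2.
  apply: IH; [exact: half_lt|exact: half_lt|].
  have -> : coset_rep n k./2 * (coset_rep n k'./2)^-1 =
      (coset_rep n.+1 k * (coset_rep n k./2)^-1)^-1 *
      (coset_rep n.+1 k * (coset_rep n.+1 k')^-1) *
      (coset_rep n.+1 k' * (coset_rep n k'./2)^-1).
    move: (coset_rep n.+1 k) (coset_rep n.+1 k') => x x'.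
    by rewrite invgF !mulgA !mulgVK.
  apply: (GM _ _ (GM _ _ (GV _ _) (Gdecr Gkk'))); exact: coset_rep_half.
move: Gkk'; rewrite -(odd_double_half k) -(odd_double_half k') kk2 /=.
rewrite !half_bit_double !oddD !odd_double !addbF !oddb.
rewrite invgM mulgA mulgK.
case: (odd k); case: (odd k') => //; rewrite ?expg0 ?expg1 ?invg1 ?mulg1 ?mul1g.
  by move/(@NGs n).
by move/GV1; rewrite invgK => /(@NGs n).
Qed.

Lemma right_cosets_rep n :
  right_cosets (G n) = (fun k => translate (G n) (coset_rep n k)) @` `I_(2 ^ n).
Proof.
apply/seteqP; split=> [_ [g _ <-]|_ [k _ <-]]; last by exists (coset_rep n k).
have [k kn Gk] := coset_rep_cover n g; exists k => //.
by apply/esym/translate_eq.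
Qed.

Lemma right_cosets_card n : (right_cosets (G n) #= `I_(2 ^ n))%card.
Proof.
rewrite right_cosets_rep; apply: inj_card_eq => k k' /set_mem kn /set_mem k'n.
by move=> /translate_eq => /(_ (Gsub n)); apply: coset_rep_inj.
Qed.

Lemma right_cosets_finite n : finite_set (right_cosets (G n)).
Proof. by apply/finite_setP; exists (2 ^ n)%N; apply: right_cosets_card. Qed.

Definition index_two_chain : chain F :=
  Chain Gsub right_cosets_finite GT Gdecr.

Lemma index_two_chain_index n : subgroup_index (index_two_chain n) = (2 ^ n)%N.
Proof. exact/card_fset_set/right_cosets_card. Qed.

Local Notation Gam := index_two_chain.

Lemma vertex_rep (v : vertex Gam) : exists2 k, k < 2 ^ level v &
  v = vertex_of Gam (level v) (coset_rep (level v) k).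
Proof.
have [g ->] := vertex_ofE v; have [k kn Gk] := coset_rep_cover (level v) g.
by exists k => //; apply/vertex_of_eq.
Qed.

Section RayOfBits.
Variable c : nat -> nat.
Hypothesis c_half : forall n, (c n.+1)./2 = c n.

Let node n := vertex_of Gam n (coset_rep n (c n)).

Lemma bits_root : node 0 = tree_root Gam. Proof. by []. Qed.

Lemma bits_adjacent n : Defs.adjacent (node n) (node n.+1).
Proof.
left; split; first by [].
have -> : coset_of_vertex (node n) = translate (G n) (coset_rep n.+1 (c n.+1)).
  by apply/esym/translate_eq => //; rewrite -(c_half n); apply: coset_rep_half.
exact/translate_sub/Gdecr.
Qed.

Lemma bits_inj : injective node.
Proof. by move=> n m /(congr1 (@level _ _)). Qed.

(** The levels of the ray are given by the truncations [c n] of an infinite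
    binary expansion. *)
Definition ray_of_bits : boundary Gam := Ray bits_root bits_adjacent bits_inj.

End RayOfBits.

(** * The boundary measure and its ergodicity *)

Section Measure.
Variable R : realType.
Import Order.TTheory GRing.Theory Num.Theory.
Local Open Scope ring_scope.

(** For [t] in [[0, 1[], the first [n] binary digits of [t], read as an integer.
    The boundary measure is the distribution of the ray described by the binary
    expansion of a uniformly distributed [t]. *)
Definition dyadic n (t : R) : nat := Num.truncn (2 ^+ n * t).

Lemma dyadic_le n t k : (dyadic n t <= k)%N = (t < k.+1%:R / 2 ^+ n).
Proof. by rewrite /dyadic truncn_le_nat ltr_pdivlMr ?exprn_gt0 // mulrC. Qed.

Lemma dyadic_half t n : (dyadic n.+1 t)./2 = dyadic n t.
Proof.
have le_half j : ((dyadic n.+1 t)./2 <= j)%N = (dyadic n t <= j)%N.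
  rewrite (_ : (_./2 <= j)%N = (dyadic n.+1 t <= j.*2.+1)%N); last by lia.
  rewrite !dyadic_le exprS -doubleS -muln2 natrM invfM mulrA mulfK //.
by apply: anti_leq; rewrite le_half leqnn -le_half leqnn.
Qed.

Lemma dyadic_eq n t k : 0 <= t ->
  (dyadic n t == k) = (k%:R / 2 ^+ n <= t < k.+1%:R / 2 ^+ n).
Proof.
move=> t0; rewrite /dyadic truncn_eq; last by rewrite mulr_ge0 ?exprn_ge0.
by rewrite ler_pdivrMr ?ltr_pdivlMr ?exprn_gt0 // [t * _]mulrC.
Qed.

Lemma measurable_dyadic n k : measurable [set t : R | dyadic n t = k].
Proof.
have mle j : measurable [set t : R | (dyadic n t <= j)%N].
  rewrite (_ : [set t | _] = `]-oo, (j.+1%:R / 2 ^+ n)[%classic).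
    exact: measurable_itv.
  by apply/seteqP; split=> t; rewrite /= in_itv /= dyadic_le.
case: k => [|k].
  rewrite (_ : [set t | _] = [set t : R | (dyadic n t <= 0)%N]).
    exact: mle.
  by apply/seteqP; split=> t /=; rewrite leqn0 => /eqP.
rewrite (_ : [set t | _] =
    [set t : R | (dyadic n t <= k.+1)%N] `\`
    [set t : R | (dyadic n t <= k)%N]).
  by apply: measurableD; apply: mle.
by apply/seteqP; split=> t /=; lia.
Qed.

Definition unit_interval : set (measurableTypeR R) := `[0, 1[%classic.

Lemma measurable_unit_interval : measurable unit_interval.
Proof. exact: measurable_itv. Qed.

Definition unit_prob : set (measurableTypeR R) -> \bar R :=
  mrestr lebesgue_measure measurable_unit_interval.

HB.instance Definition _ := Measure.on unit_prob.

Lemma unit_prob_setT : unit_prob setT = 1%E.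
Proof.
rewrite /unit_prob /mrestr setTI lebesgue_measure_itv /=.
by rewrite lte_fin ltr01 oppr0 adde0.
Qed.

HB.instance Definition _ :=
  Measure_isProbability.Build _ _ _ unit_prob unit_prob_setT.

Definition dyadic_ray (t : measurableTypeR R) : borel_boundary Gam :=
  ray_of_bits (dyadic_half t).

Lemma measurable_dyadic_ray : measurable_fun setT dyadic_ray.
Proof.
apply: (@measurability _ _ _ (borel_boundary Gam) _ _ (@open (boundary Gam))).
  by [].
move=> _ [U oU <-]; rewrite setTI.
rewrite (_ : _ @^-1` _ = \bigcup_n \bigcup_(k in [set k |
    shadow (vertex_of Gam n (coset_rep n k)) `<=` U])
    [set t : R | dyadic n t = k]).
  apply: bigcupT_measurable => n.
  by apply: bigcup_measurable => k _; apply: measurable_dyadic.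
apply/seteqP; split=> [t Ut|t [n _ [k /= sub tk]]].
  by have [n sub] := open_shadow oU Ut; exists n => //; exists (dyadic n t).
by apply: sub; exists n; rewrite /= tk.
Qed.

Lemma boundary_measure_exists :
  exists mu : probability (borel_boundary Gam) R, is_boundary_measure mu.
Proof.
pose f : {mfun measurableTypeR R >-> borel_boundary Gam} :=
  HB.pack dyadic_ray
    (isMeasurableFun.Build _ _ _ _ dyadic_ray measurable_dyadic_ray).
exists (distribution unit_prob f) => v; rewrite index_two_chain_index.
have [k kn vE] := vertex_rep v; set n := level v in kn vE *.
rewrite /distribution /pushforward /= /unit_prob /mrestr.
rewrite (_ : _ `&` _ = `[(k%:R / 2 ^+ n), (k.+1%:R / 2 ^+ n)[%classic).
  rewrite lebesgue_measure_itv /= lte_fin ltr_pM2r ?invr_gt0 ?exprn_gt0 //.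
  rewrite ltr_nat ltnSn.
  by rewrite -EFinD -mulrBl -natr1 addrC addKr mul1r natrX.
have n2 : (0 : R) < 2 ^+ n by rewrite exprn_gt0.
apply/seteqP; split=> t; rewrite /unit_interval /= !in_itv /=.
  move=> [/shadowP + /andP[t0 t1]]; rewrite vE /= => /vertex_of_eq e.
  rewrite -dyadic_eq //; apply/eqP; apply: (coset_rep_inj _ kn e).
  rewrite -(ltr_nat R) natrX (le_lt_trans (y := 2 ^+ n * t)) //.
    by rewrite truncn_le mulr_ge0 // ltW.
  by rewrite -[ltRHS]mulr1 ltr_pM2l.
move=> /andP[kt tk]; have t0 : 0 <= t.
  by apply: le_trans kt; rewrite divr_ge0 // ltW.
have t1 : t < 1.
  by apply: lt_le_trans tk _; rewrite ler_pdivrMr // mul1r -natrX ler_nat.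
rewrite t0 t1; split=> //; apply/shadowP; rewrite vE /=.
by have /eqP -> : dyadic n t == k by rewrite dyadic_eq // kt tk.
Qed.

Implicit Types (mu : probability (borel_boundary Gam) R).
Implicit Types (A : set (boundary Gam)).

Lemma measurable_shadow (v : vertex Gam) :
  measurable (shadow v : set (borel_boundary Gam)).
Proof. by apply: sub_sigma_algebra; apply: shadow_open. Qed.

Lemma measurable_fixed_points g :
  measurable (fixed_points g : set (borel_boundary Gam)).
Proof.
rewrite -[fixed_points g]setCK; apply: measurableC; apply: sub_sigma_algebra.
by rewrite /= openC; apply: fixed_points_closed.
Qed.

Lemma shadow_rootE : shadow (tree_root Gam) = setT.
Proof. by apply/seteqP; split=> // x _; exists 0%N; rewrite ray_root. Qed.

(** There are finitely many vertices on each level, so an open set is a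
    countable union of shadows. *)
Lemma borel_shadows : @measurable _ (borel_boundary Gam) =
  <<s [set A | A = set0 \/ exists v : vertex Gam, A = shadow v] >>.
Proof.
apply/seteqP; split; apply: smallest_sub; try exact: smallest_sigma_algebra.
  move=> U oU.
  rewrite (_ : U = \bigcup_n \bigcup_(k in [set k |
      shadow (vertex_of Gam n (coset_rep n k)) `<=` U])
      shadow (vertex_of Gam n (coset_rep n k))).
    apply: sigma_algebra_bigcup => n; rewrite bigcup_mkcond.
    apply: sigma_algebra_bigcup => k; apply: sub_sigma_algebra.
    by case: ifP => _; [right; exists (vertex_of Gam n (coset_rep n k))|left].
  apply/seteqP; split=> [x Ux|x [n _ [k sub]]]; last exact: sub.
  have [n sub] := open_shadow oU Ux; exists n => //.
  have [k _] := vertex_rep (x n); rewrite ray_level => xn.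
  by exists k; rewrite /= -xn //; exists n.
move=> _ [->|[v ->]]; first exact: measurable0.
exact: measurable_shadow.
Qed.

(** Two shadows are nested or disjoint, so that the shadows, with the empty set,
    form a pi-system. *)
Lemma measure_eq_shadows
    (m1 m2 : {measure set (borel_boundary Gam) -> \bar R}) :
  (forall v : vertex Gam, m1 (shadow v) = m2 (shadow v)) ->
  (m1 setT < +oo)%E -> forall A, measurable (A : set (borel_boundary Gam)) ->
  m1 A = m2 A.
Proof.
move=> m12 m1fin.
apply: (measure_unique _ (fun=> setT) borel_shadows) => //.
- move=> U V [->|[u ->]]; first by rewrite set0I; left.
  move=> [->|[v ->]]; first by rewrite setI0; left.
  have [->|/set0P[x [ux vx]]] := eqVneq (shadow u `&` shadow v) set0.
    by left.
  right; move: ux vx => /shadowP xu /shadowP xv.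
  rewrite -xu -xv; have [uv|vu] := leqP (level u) (level v).
    exists (x (level v)); apply/setIidPr; exact: shadow_sub.
  by exists (x (level u)); apply/setIidPl; apply: shadow_sub; apply: ltnW.
- by move=> _; right; exists (tree_root Gam); rewrite shadow_rootE.
- by rewrite bigcup_const //; exists 0%N.
- by move=> A [->|[v ->]]; rewrite ?measure0.
Qed.

Lemma measurable_bact g :
  measurable_fun setT
    (fun x : borel_boundary Gam => bact x g : borel_boundary Gam).
Proof.
apply: (@measurability _ _ _ (borel_boundary Gam) _ _ (@open (boundary Gam))).
  by [].
move=> _ [U oU <-]; rewrite setTI; apply: sub_sigma_algebra => /=.
exists [set v : vertex Gam | shadow (vact v g) `<=` U] => //.
apply/seteqP; split=> [x [v sub vx]|x Ux].
  by apply: sub; apply/shadow_bact.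
have [n sub] := open_shadow oU Ux; exists (x n); first exact: sub.
by exists n.
Qed.

Lemma boundary_measure_bact mu g A : is_boundary_measure mu ->
  measurable (A : set (borel_boundary Gam)) ->
  mu ((fun x : boundary Gam => bact x g) @^-1` A) = mu A.
Proof.
move=> muE; pose f : {mfun borel_boundary Gam >-> borel_boundary Gam} :=
  HB.pack (fun x : boundary Gam => bact x g)
    (isMeasurableFun.Build _ _ _ _ _ (measurable_bact g)).
apply: (@measure_eq_shadows (distribution mu f) mu); last first.
  by rewrite [X in (X < _)%E](probability_setT (distribution mu f)) ltry.
move=> v; rewrite /distribution /pushforward.
transitivity (mu (shadow (vact v g^-1%g))); last first.
  exact: etrans (muE (vact v g^-1%g)) (esym (muE v)).
congr (mu _).
apply/seteqP; split=> x; rewrite /= !shadowP /=.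
  by move=> xv; rewrite -[in RHS]xv vactM mulgV vact1.
by move=> xv; rewrite xv vactM mulVg vact1.
Qed.

(** Ergodicity. By invariance all shadows of the same level meet [A] in the same
    measure, that is [mu (shadow v `&` A) = mu A * mu (shadow v)]. Thus [A] is
    independent of all shadows, hence of all Borel sets, its complement
    included. *)
Lemma boundary_zero_one mu A : is_boundary_measure mu ->
  measurable (A : set (borel_boundary Gam)) ->
  (forall x g, A (bact x g) <-> A x) -> mu A != 0%E -> mu (~` A) = 0%E.
Proof.
move=> muE mA Ainv muA0.
have finA : mu A \is a fin_num by rewrite fin_num_measure.
pose a : {nonneg R} := NngNum (fine_ge0 (measure_ge0 mu A)).
have AI v : measurable (shadow v `&` A : set (borel_boundary Gam)).
  by apply: measurableI => //; apply: measurable_shadow.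
have shift (v : vertex Gam) g :
    mu (shadow (vact v g) `&` A) = mu (shadow v `&` A).
  rewrite -(boundary_measure_bact g muE); last exact: AI.
  congr (mu _); apply/seteqP; split=> x /=; rewrite Ainv shadow_bact //.
have half (v : vertex Gam) : mu (shadow v `&` A) = (mu A * mu (shadow v))%E.
  set n := level v; pose w (i : 'I_(2 ^ n)) := vertex_of Gam n (coset_rep n i).
  have wv i : mu (shadow (w i) `&` A) = mu (shadow v `&` A).
    have [g wg] :=
      @spherically_transitive_coset_tree _ Gam n v (w i) erefl erefl.
    by rewrite -wg shift.
  have finv : mu (shadow v `&` A) \is a fin_num by rewrite fin_num_measure.
  have : mu A = (\sum_(i < 2 ^ n) mu (shadow (w i) `&` A))%E.
    rewrite -measure_bigsetU_ord //=; last first.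
      apply/trivIsetP => i j _ _ ij; apply/seteqP; split=> // x /=.
      case=> [[/shadowP + _] [/shadowP + _]] => /= -> /vertex_of_eq e.
      by move: ij => /eqP; apply; apply/val_inj/(coset_rep_inj _ _ e).
    congr (mu _).
    rewrite -(bigcup_mkord _ (fun i =>
      shadow (vertex_of Gam n (coset_rep n i)) `&` A)).
    apply/seteqP; split=> [x Ax|x [i _ []//]].
    have [k kn xn] := vertex_rep (x n); rewrite ray_level in kn xn.
    by exists k => //; split=> //; exists n.
  rewrite (eq_bigr _ (fun i _ => wv i)) muE index_two_chain_index -/n.
  rewrite -(fineK finv) -(fineK finA) sumEFin sumr_const card_ord => -[->].
  by rewrite -EFinM -(mulr_natr (fine _)) mulfK // pnatr_eq0 expn_eq0.
have muAE : (a%:num%:E = mu A)%E by rewrite fineK.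
pose m1 : {measure set (borel_boundary Gam) -> \bar R} := mrestr mu mA.
pose m2 : {measure set (borel_boundary Gam) -> \bar R} := mscale a mu.
have m1E S : m1 S = mu (S `&` A) by [].
have m2E S : m2 S = (a%:num%:E * mu S)%E by [].
have : m1 (~` A) = m2 (~` A).
  apply: measure_eq_shadows; last exact: measurableC.
    by move=> v; rewrite m1E m2E muAE; apply: half.
  by rewrite m1E setTI ltey_eq finA.
rewrite m1E m2E setICl measure0 muAE => /esym/eqP.
by rewrite mule_eq0 (negbTE muA0) => /eqP.
Qed.

End Measure.

End IndexTwo.

(** * Typical points of the boundary have loops *)

Section TwistedChain.
Variables (d : nat) (F : groupType) (X : 'I_d -> F).
Hypothesis hX : free_basis X.
Variables (a b : 'I_d) (ab : b != a).
Variables (G : nat -> set F) (e : nat -> F * 'I_d) (s : nat -> F).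
Hypotheses (GT : G 0 = setT) (Gsub : forall n, is_subgroup (G n)).
Hypothesis GS : forall n, G n.+1 = even_part hX (G n) (e n).
Hypothesis e_b : forall n, n < 2 -> (e n).2 = b.
Hypothesis Gs : forall n, G n (s n).
Hypothesis s_odd :
  forall n, potential hX (coset_edge (G n) (e n).1 (e n).2) (s n).
Hypothesis capG : \bigcap_n G n = [set 1].
Local Notation phi n := (potential hX (coset_edge (G n) (e n).1 (e n).2)).

Lemma twisted_decr n : G n.+1 `<=` G n.
Proof. by rewrite GS => x []. Qed.

Lemma twisted_proper n : ~ G n.+1 (s n).
Proof. by rewrite GS => -[_]; rewrite s_odd. Qed.

Lemma twisted_cover n x : G n x -> G n.+1 x \/ G n.+1 (x * (s n)^-1).
Proof.
move=> Gx; have [_ GM GV] := Gsub n; rewrite GS /even_part /=.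
have := coset_potentialM hX (e n) (s n)^-1 (Gsub n) (Gs n).
rewrite mulgV potential1 s_odd => /esym/negbFE sV.
case px: (phi n x); [right|by left].
split; first by apply: GM => //; apply: GV.
by rewrite (coset_potentialM hX (e n) _ (Gsub n) Gx) px sV.
Qed.

Local Notation Gam := 
  (index_two_chain GT Gsub twisted_decr Gs twisted_proper twisted_cover).

(** The closed path of [X l] at the vertex [G n g] stays closed at stage [n.+1]
    unless it is the edge opened at stage [n]; conjugation by [g] crosses that
    edge an even number of times. *)
Lemma twisted_conj n g l : G n (g * X l * g^-1) ->
  ~ G n.+1 (g * X l * g^-1) -> l = (e n).2 /\ G n (g * (e n).1^-1).
Proof.
move=> Gg NGg; have : phi n (g * X l * g^-1).
  by apply: contrapT => /negP h; apply: NGg; rewrite GS.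
have := coset_potentialM hX (e n) g (Gsub n) Gg.
rewrite mulgVK potentialX => pg; rewrite -(addbK (phi n g) (phi n _)) -pg.
by rewrite addbAC addbb /= /coset_edge => /andP[/eqP -> /asboolP].
Qed.

Definition looped n : set (boundary Gam) :=
  [set x | vact (x n) (X a) = x n].

(** Only one vertex of level [n] has lifts that lose their loop. *)
Lemma loopedS n : looped n `<=` looped n.+1 `|`
  (if (e n).2 == a then shadow (vertex_of Gam n (e n).1) else set0).
Proof.
move=> x; have [g xg] := rayE x n.+1.
have xn : x n = vertex_of Gam n g.
  have [lx] := ray_child x n; rewrite xg => sub.
  have [h xh] := rayE x n; rewrite xh in sub *; apply/vertex_of_eq.
  have gg : translate (G n.+1) g g.
    by exists 1; rewrite ?mul1g //; case: (Gsub n.+1).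
  have [k Gk <-] := sub g gg.
  have [_ _ GV] := Gsub n.
  by rewrite invgM mulgA mulgV mul1g; apply: GV.
rewrite /looped /= xg xn !vact_vertex_of => /vertex_of_eq Gg.
have [Gg'|NGg] := pselect (G n.+1 (g * X a * g^-1)).
  by left; apply/vertex_of_eq.
right; have [<- Gge] := twisted_conj Gg NGg.
by rewrite eqxx; exists n; rewrite xn; apply/vertex_of_eq.
Qed.

Lemma looped_decr n : looped n.+1 `<=` looped n.
Proof.
move=> x; rewrite /looped /= => e1; have := ray_child (bact x (X a)) n.
by rewrite /= e1 => c; apply: parent_uniq c (ray_child x n).
Qed.

Lemma fixed_points_looped :
  fixed_points (Gam := Gam) (X a) = \bigcap_n looped n.
Proof.
apply/seteqP; split=> [x xa n _|x xn].
  by have := congr1 (fun y : boundary Gam => y n) xa.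
by apply: ray_eq => n; apply: xn.
Qed.

Lemma looped01 n : n <= 2 -> looped n = setT.
Proof.
move=> n2; apply/seteqP; split=> // x _; elim: n n2 => [|n IH] n2.
  by rewrite /looped /= ray_root vact_root.
have := loopedS (IH (ltnW n2)); rewrite e_b // (negbTE ab).
by case.
Qed.

Section MeasureOfLoops.
Variable R : realType.
Import Order.TTheory GRing.Theory Num.Theory.
Local Open Scope ring_scope.
Variable mu : probability (borel_boundary Gam) R.
Hypothesis muE : is_boundary_measure mu.

Lemma measurable_looped n : measurable (looped n : set (borel_boundary Gam)).
Proof.
apply: sub_sigma_algebra => /=.
exists [set v : vertex Gam | level v = n /\ vact v (X a) = v] => //.
apply/seteqP; split=> [x [v [<- va] /shadowP xv]|x xa].
  by rewrite /looped /= xv.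
by exists (x n); [rewrite /= ray_level|exists n].
Qed.

(** The loss is at most [2 ^- n.+2] from level [n.+2] to level [n.+3], and these
    losses add up to 1/2. *)
Lemma measure_looped n :
  ((2^-1 + 2^-1 ^+ n.+1)%:E <= mu (looped n.+2))%E.
Proof.
elim: n => [|n IH].
  by rewrite looped01 // probability_setT expr1 lee_fin; lra.
have muS : (mu (looped n.+2) <= mu (looped n.+3) + (2^-1 ^+ n.+2)%:E)%E.
  pose S : set (borel_boundary Gam) :=
    if (e n.+2).2 == a then shadow (vertex_of Gam n.+2 (e n.+2).1) else set0.
  have mS : measurable S.
    rewrite /S; case: ifP => _; last exact: measurable0.
    exact: measurable_shadow.
  have mloop k := measurable_looped k.
  have muSle : (mu S <= (2^-1 ^+ n.+2)%:E)%E.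
    rewrite /S; case: ifP => _; last by rewrite measure0 lee_fin exprn_ge0.
    by rewrite muE index_two_chain_index /= natrX exprVn.
  apply: (@le_trans _ _ (mu (looped n.+3 `|` S))).
    by apply: le_measure; rewrite ?inE; [|exact: measurableU|exact: loopedS].
  apply: (le_trans (measureU2 _ _ _)) => //.
  by rewrite leeD2l.
have := le_trans IH muS; rewrite -leeBlDr // -EFinB.
apply: le_trans; rewrite lee_fin !exprS; lra.
Qed.

Lemma measure_fixed_points : ((2^-1)%:E <= mu (fixed_points (X a)))%E.
Proof.
rewrite fixed_points_looped.
have cvg : mu \o looped @ \oo --> mu (\bigcap_n looped n).
  apply: nonincreasing_cvg_mu.
  - by rewrite -ge0_fin_numE // fin_num_measure //; apply: measurable_looped.
  - exact: measurable_looped.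
  - by apply: bigcapT_measurable; apply: measurable_looped.
  - apply/nonincreasing_seqP => n; apply/subsetPset; exact: looped_decr.
rewrite -(cvg_lim _ cvg) //; apply: lime_ge.
  by apply/cvg_ex; exists (mu (\bigcap_n looped n)).
exists 2 => // -[|[|n]] // _ /=; apply: le_trans (measure_looped n).
by rewrite lee_fin lerDl exprn_ge0.
Qed.

(** [F] is countable, so the union of the translates of the fixed points of
    [X a] is a Borel set; it is invariant and not null. *)
Lemma ae_loop :
  {ae mu, forall x : boundary Gam,
     exists g, bact (bact x g) (X a) = bact x g}.
Proof.
have [en enE] := basis_countable hX.
pose A : set (borel_boundary Gam) :=
  [set x | exists g, bact (bact x g) (X a) = bact x g].
have AE : A = \bigcup_n
    (fun x : borel_boundary Gam => bact x (en n) : borel_boundary Gam) @^-1`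
      fixed_points (X a).
  apply/seteqP; split=> [x [g xg]|x [n _ xn]]; last by exists (en n).
  by have [n ng] := enE g; exists n => //; rewrite /preimage /= ng.
have mA : measurable A.
  rewrite AE; apply: bigcupT_measurable => n; rewrite -[X in measurable X]setTI.
  by apply: measurable_bact => //; apply: measurable_fixed_points.
exists (~` A); split=> //; first exact: measurableC.
apply: (boundary_zero_one muE mA) => [x g|].
  split=> -[h xh]; first by exists (g * h)%g; rewrite -(bactM x g h).
  by exists (g^-1 * h)%g; rewrite (bactM x g) mulgA mulgV mul1g.
rewrite gt_eqF //; apply: (@lt_le_trans _ _ (2^-1)%:E).
  by rewrite lte_fin invr_gt0.
apply: le_trans measure_fixed_points _; apply: le_measure; rewrite ?inE //.
  exact: measurable_fixed_points.
by move=> x xa; exists 1%g; rewrite bact1.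
Qed.

Lemma twisted_not_essentially_free : ~ essentially_free mu.
Proof.
case=> N [mN N0 sub].
have : (mu (fixed_points (X a)) <= mu N)%E.
  apply: le_measure; rewrite ?inE //; first exact: measurable_fixed_points.
  move=> x xa; apply: sub => /= stab1.
  apply: (@expg_basis_neq1 _ _ _ hX a 1) => //.
  by have : stabilizer x (X a) by []; rewrite stab1.
by rewrite N0 leNgt (lt_le_trans _ measure_fixed_points) // lte_fin invr_gt0.
Qed.

End MeasureOfLoops.

Lemma twisted_chain_loops (R : realType) :
  exists (Gam' : chain F) (mu : probability (borel_boundary Gam') R),
    [/\ \bigcap_n Gam' n = [set 1], is_boundary_measure mu,
      ~ essentially_free mu &
      {ae mu, forall x : boundary Gam',
         exists g, bact (bact x g) (X a) = bact x g}].
Proof.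
have [mu muE] := boundary_measure_exists GT Gsub twisted_decr Gs
  twisted_proper twisted_cover R.
exists Gam, mu; split=> //; first exact: twisted_not_essentially_free.
exact: ae_loop.
Qed.

End TwistedChain.

Lemma looped_chain_exists (R : realType) (d : nat) (F : groupType)
    (X : 'I_d -> F) (a b : 'I_d) : free_basis X -> b != a ->
  exists (Gam : chain F) (mu : probability (borel_boundary Gam) R),
    [/\ \bigcap_n Gam n = [set 1], is_boundary_measure mu,
      ~ essentially_free mu &
      {ae mu, forall x : boundary Gam,
         exists g, bact (bact x g) (X a) = bact x g}].
Proof.
move=> hX ab; have [G [e [GT Gsub GS Ge capG]]] := chain_edges_exist hX b.
have odd_element n : exists x, G n x /\
    potential hX (coset_edge (G n) (e n).1 (e n).2) x.
  by have [_ [w [Gw pw _]]] := Ge n; exists (word_val X w).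
have [s sP] := choice odd_element.
apply: (twisted_chain_loops ab GT Gsub GS _ (fun n => (sP n).1)
  (fun n => (sP n).2) capG).
by move=> n; case: (Ge n).
Qed.

Unset Implicit Arguments.
Local Close Scope group_scope.

Theorem mainTheorem2 (R : realType) (d : nat) (hd : (2 <= d)%N)
    (F : groupType) (X : 'I_d -> F) (hX : free_basis X) :
  exists (Gam : chain F) (mu : probability (borel_boundary Gam) R),
    \bigcap_n Gam n = [set 1%g] /\
    is_boundary_measure mu /\
    ~ essentially_free mu /\
    (exists A : set (boundary Gam), comeager A /\
       forall x, A x -> is_regular_tree (2 * d) (schreier X x)) /\
    {ae mu, forall x : boundary Gam,
       ~ is_tree (schreier X x) /\
       exists (v : vert (schreier X x)) (r : nat),
         forall T : multigraph, is_regular_tree (2 * d) T ->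
           ~ embeds (ball_graph v r) T} /\
    spherically_transitive Gam /\
    (exists A B : set (boundary Gam),
       comeager A /\ {ae mu, forall x : boundary Gam, B x} /\
       forall x y, A x -> B y ->
         ~ locally_isomorphic (schreier X x) (schreier X y)).
Proof.
pose a := Ordinal (ltnW hd); pose b := Ordinal hd.
have ab : b != a by [].
have [Gam [mu [capG muE not_free aeB]]] := looped_chain_exists R hX ab.
exists Gam, mu.
have [en enE] := basis_countable hX.
pose A := [set x : boundary Gam | stabilizer x = [set 1%g]].
pose B := [set x : boundary Gam | exists g, bact (bact x g) (X a) = bact x g].
have comA : comeager A.
  exact: (@comeager_trivial_stabilizer F Gam en enE capG).
have treeA x : A x -> is_regular_tree (2 * d) (schreier X x).
  exact: schreier_regular_tree.
split; first exact: capG.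
split; first exact: muE.
split; first exact: not_free.
split; first by exists A.
split.
  have [N [mN N0 sub]] := aeB; exists N; split=> // x Nx.
  apply: sub => -[g xg]; apply: Nx.
  have loop := schreier_loop xg.
  split; first by case=> _; apply; apply: loop_cycle loop.
  exists (orbit_point X x g), 0%N => T [[_ Tac] _].
  exact: loop_ball_not_embeds loop Tac.
split; first exact: spherically_transitive_coset_tree.
exists A, B; split=> //; split=> // x y Ax [g yg].
have [[_ acx] _] := treeA x Ax.
exact: not_locally_isomorphic_loop acx (schreier_loop yg).
Qed.
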